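(* Let $H=\mathcal{P}(G,R,D)$ be the pointed Hopf algebra defined in the context, and let $u:H\to A$ define an inner action of $H$ on a matrix algebra $A$ over $\mathbb{F}$. Then for each $i=1,\dots,n$ there is $\sigma_i\in\mathbb{F}$ such that $$u(x_i)^{N_i}=\mu_i\,1_A+\sigma_i\,u(a_i)^{N_i}.$$
   Context: Let $\mathbb{F}$ be a field, $G$ a finite nontrivial abelian group, $\widehat{G}=\mathrm{Hom}(G,\mathbb{F}^\times)$ with $|\widehat{G}|=|G|$, and $\varepsilon$ the trivial character. Let $a_1,\dots,a_n\in G$, $\chi_1,\dots,\chi_n\in\widehat{G}$ satisfy $q_i:=\chi_i(a_i)\neq1$ for all $i$ and $\chi_j(a_i)\chi_i(a_j)=1$ for $i\ne j$ (the datum of a quantum linear space $R$ of rank $n$). Let $N_i$ be the order of $q_i$ in $\mathbb{F}^\times$. A compatible datum $D$ consists of $\mu_i\in\{0,1\}$ and $\lambda_{ij}\in\mathbb{F}$ ($1\le i<j\le n$) such that $\mu_i=0$ if $a_i^{N_i}=1$ or $\chi_i^{N_i}\ne\varepsilon$, and $\lambda_{ij}=0$ if $a_ia_j=1$ or $\chi_i\chi_j\neq\varepsilon$. The Hopf algebra $\mathcal{P}(G,R,D)$ is generated by $G$ and $x_1,\dots,x_n$ subject to the relations of $G$ and: $gx_i=\chi_i(g)x_ig$ for $g\in G$; $x_i^{N_i}=\mu_i(1-a_i^{N_i})$; $x_jx_i=\chi_i(a_j)x_ix_j+\lambda_{ij}(1-a_ia_j)$ for $i<j$; with $\Delta(g)=g\otimes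 g$ for $g\in G$ and $\Delta(x_i)=x_i\otimes1+a_i\otimes x_i$. An action of $H$ on $A$ is an $H$-module algebra structure $(h,a)\mapsto h*a$. It is inner, via a convolution invertible linear map $u:H\to A$ normalized by $u(1)=1_A$, if $h*a=\sum u(h_{(1)})\,a\,u^{-1}(h_{(2)})$, with $u^{-1}$ the convolution inverse; thus $g*a=u(g)au(g)^{-1}$ and $x_i*a=u(x_i)a-u(a_i)au(a_i)^{-1}u(x_i)$. *)

(* Defs.v *)
From HB Require Import structures.
From mathcomp Require Import all_boot all_order all_algebra all_fingroup.
From mathcomp Require Import ring_quotient generic_quotient.
From mathcomp.classical Require Import boolp.
From mathcomp.finmap Require Import finmap.
From mathcomp.multinomials Require Import monalg.

Set Implicit Arguments.
Unset Strict Implicit.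
Unset Printing Implicit Defensive.

Import GRing.Theory.
Local Open Scope ring_scope.
Local Open Scope quotient_scope.

Section LinearQuotient.
Variables (F : fieldType) (V : lmodType F).

Inductive span (rel : V -> Prop) : V -> Prop :=
| span_gen r of rel r : span rel r
| span_zero : span rel 0
| span_lin c x y of span rel x & span rel y : span rel (c *: x + y).

Variable rel : V -> Prop.

Definition span_pred : {pred V} := fun x => `[< span rel x >].

Lemma span_zmod_closed : zmod_closed span_pred.
Proof.
split=> [|x y]; rewrite !unfold_in; first exact/asboolP/span_zero.
move=> /asboolP sx /asboolP sy; apply/asboolP.
by rewrite addrC -scaleN1r; apply: span_lin.
Qed.
HB.instance Definition _ := GRing.isZmodClosed.Build V span_pred span_zmod_closed.

Definition lquot : Type := Quotient.quot span_pred.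
HB.instance Definition _ := GRing.Zmodule.on lquot.

Definition lpi (x : V) : lquot := \pi_(Quotient.quot span_pred) x.

Lemma lpi_eq x y : lpi x = lpi y <-> span rel (x - y).
Proof.
rewrite /lpi; split=> [/eqP|sxy].
  by rewrite -Quotient.idealrBE unfold_in => /asboolP.
by apply/eqP; rewrite -Quotient.idealrBE unfold_in; apply/asboolP.
Qed.

Lemma lpi_repr (x : lquot) : lpi (repr x) = x. Proof. exact: reprK. Qed.

Lemma lpi_surj (P : lquot -> Prop) : (forall x, P (lpi x)) -> forall x, P x.
Proof. by move=> PP x; rewrite -[x]lpi_repr. Qed.

Lemma lpi_is_zmod_morphism : zmod_morphism lpi.
Proof. by move=> x y; rewrite /lpi [LHS]raddfB. Qed.
HB.instance Definition _ :=
  GRing.isZmodMorphism.Build V lquot lpi lpi_is_zmod_morphism.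

Lemma span_scale c x : span rel x -> span rel (c *: x).
Proof.
by move=> sx; rewrite -[_ *: _]addr0; apply: span_lin => //; apply: span_zero.
Qed.

Definition lquot_scale (c : F) (x : lquot) : lquot := lpi (c *: repr x).

Lemma lpi_scale c x : lquot_scale c (lpi x) = lpi (c *: x).
Proof.
apply/lpi_eq; rewrite -scalerBr; apply: span_scale.
by apply/lpi_eq; rewrite lpi_repr.
Qed.

Fact lquot_scaleA a b x : lquot_scale a (lquot_scale b x) = lquot_scale (a * b) x.
Proof. by elim/lpi_surj: x => x; rewrite !lpi_scale scalerA. Qed.
Fact lquot_scale1 : left_id 1 lquot_scale.
Proof. by elim/lpi_surj=> x; rewrite lpi_scale scale1r. Qed.
Fact lquot_scaleDr : right_distributive lquot_scale +%R.
Proof.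
move=> c; elim/lpi_surj=> x; elim/lpi_surj=> y.
by rewrite -raddfD !lpi_scale scalerDr raddfD.
Qed.
Fact lquot_scaleDl x : {morph lquot_scale^~ x : a b / a + b}.
Proof. by elim/lpi_surj: x => x a b; rewrite !lpi_scale scalerDl raddfD. Qed.
HB.instance Definition _ := GRing.Zmodule_isLmodule.Build F lquot
  lquot_scaleA lquot_scale1 lquot_scaleDr lquot_scaleDl.

Lemma lpi_is_scalable : scalable lpi.
Proof. by move=> c x; rewrite -lpi_scale. Qed.
HB.instance Definition _ := GRing.isScalable.Build F V lquot *:%R lpi lpi_is_scalable.

Lemma span_ker (W : lmodType F) (f : {linear V -> W}) :
  (forall r, rel r -> f r = 0) -> forall x, span rel x -> f x = 0.
Proof.
move=> f0 x; elim=> [r /f0//||c y z _ fy _ fz]; first exact: raddf0.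
by rewrite linearP fy fz scaler0 addr0.
Qed.

Lemma lquot_lift (W : lmodType F) (f : {linear V -> W}) :
  (forall r, rel r -> f r = 0) -> forall x, f (repr (lpi x)) = f x.
Proof.
move=> f0 x; apply/eqP; rewrite -subr_eq0 -raddfB; apply/eqP.
by apply: span_ker => //; apply/lpi_eq; rewrite lpi_repr.
Qed.

End LinearQuotient.

Section Tensor.
Variables (F : fieldType) (U V : lmodType F).

Inductive tensor_rel : {malg F[(U * V)%type]} -> Prop :=
| tensor_relDl c u u' v :
    tensor_rel (<< (c *: u + u', v) >> - (c *: << (u, v) >> + << (u', v) >>))
| tensor_relDr c u v v' :
    tensor_rel (<< (u, c *: v + v') >> - (c *: << (u, v) >> + << (u, v') >>)).

Definition tensor : Type := lquot tensor_rel.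
HB.instance Definition _ := GRing.Lmodule.on tensor.

Definition tens (u : U) (v : V) : tensor := lpi tensor_rel << (u, v) >>.

Section Lift.
Variable (W : lmodType F).

Definition malg_lift (f : U -> V -> W) (t : {malg F[(U * V)%type]}) : W :=
  \sum_(k <- msupp t) t@_k *: f k.1 k.2.

(* For bilinear f, the linear map with u (x) v |-> f u v (see tlift_tens and
   tlift_is_linear); junk for other f. *)
Definition tlift (f : U -> V -> W) (t : tensor) : W := malg_lift f (repr t).

Definition is_bilinear (f : U -> V -> W) : Prop :=
  (forall v, linear (f^~ v)) /\ (forall u, linear (f u)).

Lemma malg_liftEw f (d : {fset (U * V)%type}) t : (msupp t `<=` d)%fset ->
  malg_lift f t = \sum_(k <- d) t@_k *: f k.1 k.2.
Proof.
move=> le; rewrite /malg_lift (big_fset_incl _ le) => //= x xd /mcoeff_outdom ->.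
by rewrite scale0r.
Qed.

Lemma malg_lift_is_linear f : linear (malg_lift f).
Proof.
move=> c s t; pose d := (msupp s `|` msupp t `|` msupp (c *: s + t))%fset.
rewrite 3?(@malg_liftEw _ d) /d ?fsubsetUr //; last first.
- exact: fsubset_trans (fsubsetUl _ _) (fsubsetUl _ _).
- exact: fsubset_trans (fsubsetUr _ _) (fsubsetUl _ _).
rewrite scaler_sumr -big_split; apply: eq_bigr => k _ /=.
by rewrite mcoeffD mcoeffZ scalerDl scalerA.
Qed.
HB.instance Definition _ f :=
  GRing.isLinear.Build F {malg F[(U * V)%type]} W *:%R (malg_lift f) (malg_lift_is_linear f).

Lemma malg_liftU f u v : malg_lift f << (u, v) >> = f u v.
Proof.
by rewrite (malg_liftEw _ msuppU_le) big_seq_fset1 mcoeffUU scale1r.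
Qed.

Lemma malg_lift0 f : is_bilinear f -> forall r, tensor_rel r -> malg_lift f r = 0.
Proof.
case=> fl fr r [] *; rewrite linearB linearD linearZ /= !malg_liftU.
  by rewrite fl subrr.
by rewrite fr subrr.
Qed.

Lemma tlift_tens f : is_bilinear f -> forall u v, tlift f (tens u v) = f u v.
Proof. by move=> /malg_lift0 f0 u v; rewrite /tlift lquot_lift //= malg_liftU. Qed.

Lemma tlift_is_linear f : is_bilinear f -> linear (tlift f).
Proof.
move=> /malg_lift0 f0 c; elim/lpi_surj=> s; elim/lpi_surj=> t.
by rewrite -linearP /tlift !lquot_lift // linearP.
Qed.
End Lift.

Lemma tens_bilinear : is_bilinear tens.
Proof.
split=> [v c u u'|u c v v']; rewrite /tens -linearP; apply/lpi_eq.
  exact/span_gen/tensor_relDl.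
exact/span_gen/tensor_relDr.
Qed.

Lemma tensor_ind (P : tensor -> Prop) :
  P 0 -> (forall c u v t, P t -> P (c *: tens u v + t)) -> forall t, P t.
Proof.
move=> P0 PD; elim/lpi_surj=> t; rewrite (monalgE t).
elim: (enum_fset _) => [|k s IH]; first by rewrite big_nil raddf0.
rewrite big_cons raddfD /=.
have -> : << t@_k *g k >> = t@_k *: << (k.1, k.2) >> :> {malg F[(U * V)%type]}.
  by rewrite -surjective_pairing; apply/malgP=> j; rewrite mcoeffZ !mcoeffU mulrnAr mulr1.
by rewrite linearZ; apply: PD.
Qed.

End Tensor.

Arguments tlift {F U V W} f t.
Notation "U ⊗' V" := (tensor U V) (at level 40, left associativity) : type_scope.
Notation "u ⊗ v" := (tens u v) (at level 40, left associativity) : ring_scope.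

Definition tens_mul (F : fieldType) (A B : algType F) (s t : A ⊗' B) : A ⊗' B :=
  tlift (fun a b => tlift (fun a' b' => (a * a') ⊗ (b * b')) t) s.

Record hopf_structure (F : fieldType) (H : algType F) := HopfStructure {
  comul : {linear H -> H ⊗' H};
  counit : {lrmorphism H -> F | *%R};
  antipode : {linear H -> H};
  comul1 : comul 1 = 1 ⊗ 1;
  comulM : forall h k, comul (h * k) = tens_mul (comul h) (comul k);
  (* (Delta (x) id) Delta = (id (x) Delta) Delta, both read in H (x) (H (x) H) *)
  comulA : forall h,
    tlift (fun x y => tlift (fun p q => p ⊗ (q ⊗ y)) (comul x)) (comul h) =
    tlift (fun x y => x ⊗ comul y) (comul h);
  counitl : forall h, tlift (fun x y => counit x *: y) (comul h) = h;
  counitr : forall h, tlift (fun x y => counit y *: x) (comul h) = h;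
  antipodel : forall h, tlift (fun x y => antipode x * y) (comul h) = (counit h)%:A;
  antipoder : forall h, tlift (fun x y => x * antipode y) (comul h) = (counit h)%:A
}.

Section HopfActions.
Variables (F : fieldType) (H : algType F) (S : hopf_structure H).

(* Sweedler notation: [sweedler h f] is the sum of the f h_(1) h_(2). *)
Definition sweedler (W : lmodType F) (h : H) (f : H -> H -> W) : W :=
  tlift f (comul S h).

Variable A : algType F.

Definition conv_inverse (u v : {linear H -> A}) : Prop :=
  forall h, sweedler h (fun h1 h2 => u h1 * v h2) = (counit S h)%:A /\
            sweedler h (fun h1 h2 => v h1 * u h2) = (counit S h)%:A.

Record module_algebra (act : H -> A -> A) : Prop := ModuleAlgebra {
  act_linearl : forall a, linear (act^~ a);
  act_linearr : forall h, linear (act h);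
  act1h : forall a, act 1 a = a;
  actMh : forall h k a, act (h * k) a = act h (act k a);
  act_h1 : forall h, act h 1 = (counit S h)%:A;
  act_hM : forall h a b, act h (a * b) = sweedler h (fun h1 h2 => act h1 a * act h2 b)
}.

Definition inner_via (act : H -> A -> A) (u : {linear H -> A}) : Prop :=
  u 1 = 1 /\
  exists2 v : {linear H -> A}, conv_inverse u v &
    forall h a, act h a = sweedler h (fun h1 h2 => u h1 * a * v h2).

End HopfActions.

Section FreeAlgebra.
Variables (F : fieldType) (I : choiceType).

Definition free_alg : Type := {malg F[{fmonom I}]}.
HB.instance Definition _ := GRing.Lalgebra.on free_alg.

Fact free_scalerAr (c : F) (x y : free_alg) : c *: (x * y) = x * (c *: y).
Proof.
suff cC z : z * c%:MP = c *: z :> {malg F[{fmonom I}]}.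
  by rewrite -!mul_malgC [in RHS]mulrA cC -mul_malgC mulrA.
rewrite malgM_def fgmulgU malgZ_def; apply: eq_bigr => k _.
by rewrite mulm1 mulrC.
Qed.
HB.instance Definition _ :=
  GRing.Lalgebra_isAlgebra.Build F free_alg free_scalerAr.

Definition free_gen (i : I) : free_alg := << fmu i >>.

Section Lift.
Variables (B : algType F) (f : I -> B).

Definition word_eval (w : {fmonom I}) : B := \prod_(i <- fmonom_val w) f i.
Fact word_eval_is_mmorphism : mmorphism word_eval.
Proof.
split=> [x y|]; rewrite /word_eval; first by rewrite fmM big_cat.
by rewrite fm1 big_nil.
Qed.
HB.instance Definition _ :=
  isMultiplicative.Build {fmonom I} B word_eval word_eval_is_mmorphism.

Definition free_lift (x : free_alg) : B := mmap (in_alg B) word_eval x.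

Fact free_lift_is_zmod_morphism : zmod_morphism free_lift.
Proof. by move=> x y; rewrite /free_lift mmapB. Qed.
HB.instance Definition _ :=
  GRing.isZmodMorphism.Build free_alg B free_lift free_lift_is_zmod_morphism.
Fact free_lift_is_monoid_morphism : monoid_morphism free_lift.
Proof.
have [|M1 M2] := @commr_mmap_is_multiplicative _ _ _ (in_alg B) word_eval.
  by move=> g m m'; rewrite /GRing.comm /= mulr_algl mulr_algr.
by split.
Qed.
HB.instance Definition _ :=
  GRing.isMonoidMorphism.Build free_alg B free_lift free_lift_is_monoid_morphism.
Fact free_lift_is_scalable : scalable free_lift.
Proof. by move=> c x; rewrite /free_lift mmapZ /= mulr_algl. Qed.
HB.instance Definition _ :=
  GRing.isScalable.Build F free_alg B *:%R free_lift free_lift_is_scalable.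

Lemma free_lift_gen i : free_lift (free_gen i) = f i.
Proof. by rewrite /free_lift mmapU /= scale1r mul1r /word_eval fmU big_seq1. Qed.
End Lift.
End FreeAlgebra.

Section PresentedAlgebra.
Variables (F : fieldType) (A : algType F) (rel : A -> A -> Prop).

Inductive sandwich : A -> Prop :=
| Sandwich a l r b of rel l r : sandwich (a * (l - r) * b).

(* The two-sided ideal generated by the l - r with rel l r. *)
Definition ideal := span sandwich.

Lemma idealMl a r : ideal r -> ideal (a * r).
Proof.
elim=> [_ [b l r' c rr]||c x y _ sx _ sy].
- by rewrite !mulrA; apply: span_gen; apply: Sandwich.
- by rewrite mulr0; apply: span_zero.
by rewrite mulrDr -scalerAr; apply: span_lin.
Qed.

Lemma idealMr a r : ideal r -> ideal (r * a).
Proof.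
elim=> [_ [b l r' c rr]||c x y _ sx _ sy].
- by rewrite -(mulrA _ c); apply: span_gen; apply: Sandwich.
- by rewrite mul0r; apply: span_zero.
by rewrite mulrDl -scalerAl; apply: span_lin.
Qed.

(* mathcomp rings are nontrivial, hence the hypothesis. *)
Definition presented of ~ ideal 1 : Type := lquot sandwich.

Variable nt : ~ ideal 1.
Local Notation Q := (presented nt).
HB.instance Definition _ := GRing.Lmodule.on Q.

Definition presented_pi (x : A) : Q := lpi sandwich x.
Local Notation pi := presented_pi.
Fact presented_pi_is_linear : linear pi.
Proof. by move=> c x y; rewrite /pi [LHS]linearP. Qed.
HB.instance Definition _ := GRing.isLinear.Build F A Q *:%R pi presented_pi_is_linear.

Definition presented_mul (x y : Q) : Q := pi (repr x * repr y).

Lemma presented_pi_mul x y : presented_mul (pi x) (pi y) = pi (x * y).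
Proof.
apply/lpi_eq; set x' := repr _; set y' := repr _.
have -> : x' * y' - x * y = x' * (y' - y) + (x' - x) * y.
  by rewrite mulrBr mulrBl addrA subrK.
rewrite -[x' * _]scale1r; apply: span_lin.
  by apply: idealMl; apply/lpi_eq; rewrite lpi_repr.
by apply: idealMr; apply/lpi_eq; rewrite lpi_repr.
Qed.

Lemma presented_ind (P : Q -> Prop) : (forall x, P (pi x)) -> forall x, P x.
Proof. exact: lpi_surj. Qed.

Fact presented_mulA : associative presented_mul.
Proof.
elim/presented_ind=> x; elim/presented_ind=> y; elim/presented_ind=> z.
by rewrite !presented_pi_mul mulrA.
Qed.
Fact presented_mul1 : left_id (pi 1) presented_mul.
Proof. by elim/presented_ind=> x; rewrite presented_pi_mul mul1r. Qed.
Fact presented_1mul : right_id (pi 1) presented_mul.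
Proof. by elim/presented_ind=> x; rewrite presented_pi_mul mulr1. Qed.
Fact presented_mulDl : left_distributive presented_mul +%R.
Proof.
elim/presented_ind=> x; elim/presented_ind=> y; elim/presented_ind=> z.
by rewrite -raddfD !presented_pi_mul -raddfD mulrDl.
Qed.
Fact presented_mulDr : right_distributive presented_mul +%R.
Proof.
elim/presented_ind=> x; elim/presented_ind=> y; elim/presented_ind=> z.
by rewrite -raddfD !presented_pi_mul -raddfD mulrDr.
Qed.
Fact presented_neq0 : pi 1 != 0.
Proof.
apply/eqP => e; apply: nt; rewrite -[1]subr0; apply/lpi_eq.
by rewrite [LHS]e raddf0.
Qed.
HB.instance Definition _ := GRing.Zmodule_isNzRing.Build Q
  presented_mulA presented_mul1 presented_1mul presented_mulDl presented_mulDr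
  presented_neq0.

Fact presented_pi_is_monoid_morphism : monoid_morphism pi.
Proof. by split=> // x y; rewrite -presented_pi_mul. Qed.
HB.instance Definition _ :=
  GRing.isMonoidMorphism.Build A Q pi presented_pi_is_monoid_morphism.

Fact presented_scalerAl (c : F) (x y : Q) : c *: (x * y) = c *: x * y.
Proof.
elim/presented_ind: x => x; elim/presented_ind: y => y.
by rewrite -rmorphM -!linearZ -rmorphM /= scalerAl.
Qed.
HB.instance Definition _ := GRing.Lmodule_isLalgebra.Build F Q presented_scalerAl.
Fact presented_scalerAr (c : F) (x y : Q) : c *: (x * y) = x * (c *: y).
Proof.
elim/presented_ind: x => x; elim/presented_ind: y => y.
by rewrite -rmorphM -!linearZ -rmorphM /= scalerAr.
Qed.
HB.instance Definition _ := GRing.Lalgebra_isAlgebra.Build F Q presented_scalerAr.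

Lemma presented_rel l r : rel l r -> pi l = pi r.
Proof.
move=> rr; apply/lpi_eq.
by rewrite -[_ - _]mulr1 -[_ - _]mul1r; apply: span_gen; apply: Sandwich.
Qed.
End PresentedAlgebra.

Lemma ideal_ker (F : fieldType) (A B : algType F) (rel : A -> A -> Prop)
    (f : {lrmorphism A -> B}) :
  (forall l r, rel l r -> f l = f r) -> forall z, ideal rel z -> f z = 0.
Proof.
move=> f0; apply: (span_ker (f := f)) => _ [a l r b /f0 fr].
by rewrite !rmorphM /= raddfB /= fr subrr mulr0 mul0r.
Qed.

Lemma ideal_proper (F : fieldType) (A B : algType F) (rel : A -> A -> Prop)
    (f : {lrmorphism A -> B}) :
  (forall l r, rel l r -> f l = f r) -> ~ ideal rel 1.
Proof.
move=> f0 /(ideal_ker f0) f10; have /eqP := oner_neq0 B; apply.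
by rewrite -(rmorph1 f).
Qed.

Record character (F : fieldType) (gT : finGroupType) := Character {
  character_val :> gT -> F;
  character1 : character_val 1%g = 1;
  characterM : forall g h, character_val (g * h)%g = character_val g * character_val h
}.

Definition trivial_char (F : fieldType) (gT : finGroupType) (c : gT -> F) : Prop :=
  forall g, c g = 1.

(* Datum of a quantum linear space; qq and qN below are its q_i and N_i. *)
Record qls (F : fieldType) (gT : finGroupType) (n : nat) := QLS {
  qa : 'I_n -> gT;
  qchi : 'I_n -> character F gT;
  qls_neq1 : forall i, qchi i (qa i) != 1;
  qls_braid : forall i j, i != j -> qchi j (qa i) * qchi i (qa j) = 1
}.

Section QuantumLinearSpace.
Variables (F : fieldType) (gT : finGroupType) (n : nat) (R : qls F gT n).

Definition qq (i : 'I_n) : F := qchi R i (qa R i).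

Lemma qls_ord_ex i : exists N, (0 < N)%N && (qq i ^+ N == 1).
Proof.
exists #[qa R i]%g; rewrite order_gt0 /qq.
have -> N : qchi R i (qa R i) ^+ N = qchi R i (qa R i ^+ N)%g.
  elim: N => [|N IH]; first by rewrite expg0 character1.
  by rewrite exprS IH expgS characterM.
by rewrite expg_order character1 eqxx.
Qed.

Definition qN (i : 'I_n) : nat := ex_minn (qls_ord_ex i).

Lemma qN_prim i : (qN i).-primitive_root (qq i).
Proof.
rewrite /qN; case: ex_minnP => N /andP[N0 qN1] Nmin.
have [M pM dM] := prim_order_exists N0 (eqP qN1).
have M0 := prim_order_gt0 pM.
have : (N <= M)%N by apply: Nmin; rewrite M0 prim_expr_order ?eqxx.
by move=> NM; have /eqP <- : M == N by rewrite eqn_leq NM dvdn_leq.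
Qed.

(* lam i j is only meaningful for i < j. *)
Record datum := Datum {
  mu : 'I_n -> bool;
  lam : 'I_n -> 'I_n -> F;
  mu_eq0 : forall i,
    (qa R i ^+ qN i)%g = 1%g \/ ~ trivial_char (fun g => qchi R i g ^+ qN i) ->
    mu i = false;
  lam_eq0 : forall i j : 'I_n, (i < j)%N ->
    (qa R i * qa R j)%g = 1%g \/ ~ trivial_char (fun g => qchi R i g * qchi R j g) ->
    lam i j = 0
}.

Variable D : datum.

(* The defining relations l = r among elements bg g, bx i of an algebra. *)
Inductive P_rel (B : algType F) (bg : gT -> B) (bx : 'I_n -> B) : B -> B -> Prop :=
| P_one : P_rel bg bx (bg 1%g) 1
| P_mul g h : P_rel bg bx (bg (g * h)%g) (bg g * bg h)
| P_comm g i : P_rel bg bx (bg g * bx i) (qchi R i g *: (bx i * bg g))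
| P_pow i : P_rel bg bx
    (bx i ^+ qN i) ((mu D i)%:R *: (1 - bg (qa R i ^+ qN i)%g))
| P_link (i j : 'I_n) of (i < j)%N : P_rel bg bx
    (bx j * bx i)
    (qchi R i (qa R j) *: (bx i * bx j) + lam D i j *: (1 - bg (qa R i * qa R j)%g)).

Lemma P_rel_map (A B : algType F) (f : {lrmorphism A -> B}) ag ax l r :
  P_rel ag ax l r -> P_rel (f \o ag) (f \o ax) (f l) (f r).
Proof.
case=> [|g h|g i|i|i j ltij].
- by rewrite rmorph1; apply: (P_one (f \o ag)).
- by rewrite rmorphM; apply: (P_mul (f \o ag)).
- by rewrite linearZ !rmorphM; apply: (P_comm (f \o ag)).
- by rewrite linearZ /= raddfB /= rmorph1 rmorphXn; apply: (P_pow (f \o ag)).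
rewrite raddfD /= !linearZ /= raddfB /= rmorph1 !rmorphM.
exact: (P_link (f \o ag)).
Qed.

Lemma P_rel_image (A B : algType F) (f : {lrmorphism A -> B}) ag ax l r :
    (forall x y, P_rel ag ax x y -> f x = f y) ->
  P_rel (fun g => f (ag g)) (fun i => f (ax i)) l r -> l = r.
Proof.
move=> fE; case=> [|g h|g i|i|i j ltij].
- by rewrite (fE _ _ (P_one ag ax)) rmorph1.
- by rewrite (fE _ _ (P_mul ag ax g h)) rmorphM.
- by rewrite -!rmorphM /= (fE _ _ (P_comm ag ax g i)) linearZ.
- by rewrite -rmorphXn /= (fE _ _ (P_pow ag ax i)) linearZ /= raddfB /= rmorph1.
rewrite -!rmorphM /= (fE _ _ (P_link ag ax ltij)).
by rewrite raddfD /= !linearZ /= raddfB /= rmorph1.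
Qed.

(* G and {x_1, ..., x_n} *)
Definition P_gens : choiceType := (gT + 'I_n)%type.
Definition P_free : algType F := free_alg F P_gens.
Definition P_fgrp (g : gT) : P_free := free_gen F (inl g : P_gens).
Definition P_fvar (i : 'I_n) : P_free := free_gen F (inr i : P_gens).

Lemma P_proper : ~ ideal (P_rel P_fgrp P_fvar) 1.
Proof.
pose e (s : P_gens) : F^o := if s is inl _ then 1 else 0.
apply: (ideal_proper (f := free_lift e)) => l r /(P_rel_map (free_lift e)).
have -> : free_lift e \o P_fgrp = (fun=> 1).
  by apply/funext => g; rewrite /= free_lift_gen.
have -> : free_lift e \o P_fvar = (fun=> 0).
  by apply/funext => g; rewrite /= free_lift_gen.
case=> [|g h|g i|i|i j ltij] //.
- by rewrite mulr1.
- by rewrite mulr0 mul0r scaler0.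
- by rewrite subrr scaler0 expr0n eqn0Ngt (prim_order_gt0 (qN_prim i)).
by rewrite !mulr0 subrr !scaler0 addr0.
Qed.

Definition P : algType F := presented P_proper.

Definition Pgrp (g : gT) : P := presented_pi P_proper (P_fgrp g).
Definition Pvar (i : 'I_n) : P := presented_pi P_proper (P_fvar i).

Lemma P_relation l r : P_rel Pgrp Pvar l r -> l = r.
Proof.
exact: (P_rel_image (f := presented_pi P_proper) (presented_rel P_proper)).
Qed.

End QuantumLinearSpace.

(* Main.v *)
(* Write T = u(a_i), X = u(x_i), q = q_i, N = N_i. Then a_i acts as conjugation
   by T and x_i as the twisted inner derivation d_X(B) = X B - T B T^-1 X. The
   relation a_i x_i = q x_i a_i forces T X T^-1 - q X to intertwine the identity
   with conjugation by T, so it is a multiple of T, a matrix algebra being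
   central. As d_X does not change when a multiple of T is added to X, X can be
   replaced by some Y = X + c T with T Y = q Y T. Left multiplication by Y and
   B |-> - T B T^-1 Y then q-commute, so the q-binomial theorem at a primitive
   N-th root of unity gives d_Y^N(B) = Y^N B - T^N B T^-N Y^N. Comparing with the
   action of x_i^N = mu_i (1 - a_i^N) shows that Y^N - mu_i intertwines the
   identity with conjugation by T^N, hence is a multiple of T^N; and
   X^N = (Y - c T)^N = Y^N + (- c)^N T^N, again by the q-binomial theorem. *)
Require Import Defs.
From HB Require Import structures.
From mathcomp Require Import all_boot all_order all_algebra all_fingroup.
From mathcomp Require Import ring.
Import GRing.Theory.
Local Open Scope ring_scope.

(** * Gaussian binomials at roots of unity *)

Set Implicit Arguments.
Unset Strict Implicit.

(** Gaussian binomial coefficient, given by its q-Pascal recursion since the quotient of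
    q-factorials has denominators that may vanish at roots of unity. *)
Fixpoint qbin (F : fieldType) (q : F) (n k : nat) : F :=
  match n, k with
  | _, 0 => 1
  | 0, _.+1 => 0
  | n'.+1, k'.+1 => qbin q n' k' + q ^+ k'.+1 * qbin q n' k'.+1
  end.

Arguments qbin : simpl never.

Section GaussianBinomial.
Variables (F : fieldType) (q : F).
Local Notation qbin := (qbin q).

Lemma qbinn0 n : qbin n 0 = 1. Proof. by case: n. Qed.

Lemma qbinSS n k : qbin n.+1 k.+1 = qbin n k + q ^+ k.+1 * qbin n k.+1.
Proof. by []. Qed.

Lemma qbin_small n k : (n < k)%N -> qbin n k = 0.
Proof.
elim: n k => [|n IH] [|k] // ltnk.
by rewrite qbinSS !IH ?mulr0 ?addr0 // ltnW.
Qed.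

Lemma qbinnn n : qbin n n = 1.
Proof.
elim: n => [|n IH]; first exact: qbinn0.
by rewrite qbinSS IH qbin_small // mulr0 addr0.
Qed.

(** Ratio of neighbouring coefficients with denominators cleared, so that it survives
    [q ^+ k.+1 = 1]. *)
Lemma qbin_step n k : (k <= n)%N ->
  (1 - q ^+ k.+1) * qbin n k.+1 = (1 - q ^+ (n - k)) * qbin n k.
Proof.
elim: n k => [|n IH] k lekn.
  by move: lekn; rewrite leqn0 => /eqP ->; rewrite /= mulr0 subrr mul0r.
case: k lekn => [_|k].
  rewrite qbinSS !qbinn0 mulrDr mulrCA IH // qbinn0 !subn0 !exprS expr0; ring.
rewrite ltnS leq_eqVlt => /orP[/eqP ->|ltkn].
  by rewrite subnn subrr mul0r qbin_small ?mulr0.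
rewrite subSS (qbinSS n k.+1) mulrDr (mulrCA (1 - _)) IH //.
rewrite (qbinSS n k) [RHS]mulrDr -(IH k) 1?ltnW //.
have -> : (n - k = (n - k.+1).+1)%N by rewrite subnSK.
by rewrite !exprS; ring.
Qed.

Lemma qbin_absorb n k : (k <= n)%N ->
  (1 - q ^+ k.+1) * qbin n.+1 k.+1 = (1 - q ^+ n.+1) * qbin n k.
Proof.
move=> lekn; rewrite qbinSS mulrDr mulrCA qbin_step // mulrA -mulrDl.
by rewrite mulrBr mulr1 -exprD addSn subnKC // addrA subrK.
Qed.

(** In [qbin_absorb] the right side acquires the factor [1 - q ^+ n = 0], while primitivity keeps
    [1 - q ^+ k] nonzero. *)
Lemma qbin_prim_root n k : n.-primitive_root q -> (0 < k < n)%N -> qbin n k = 0.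
Proof.
case: n k => // n [//|k] qn /= ltkn.
have/eqP := @qbin_absorb n k (ltnW ltkn).
rewrite (prim_expr_order qn) subrr mul0r; rewrite mulf_eq0 => /orP[|/eqP->] //.
rewrite subr_eq0 eq_sym -(prim_order_dvd qn) => /dvdn_leq.
by move=> /(_ isT); rewrite leqNgt ltkn.
Qed.

End GaussianBinomial.

(** * The q-binomial theorem *)

Section QBinomialTheorem.
Variables (F : fieldType) (q : F).

(** Phrased for operators, to serve both twisted derivations and, through left multiplications,
    algebra elements. Moving [g] past [iter k f] costs [q ^+ k], the weight in the Pascal rule. *)
Lemma iter_qcommD (V : lmodType F) (f g : {linear V -> V}) n v :
  (forall w, g (f w) = q *: f (g w)) ->
  iter n (fun w => f w + g w) v =
    \sum_(k < n.+1) qbin q n k *: iter k f (iter (n - k) g v).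
Proof.
move=> fg; have gf k w : g (iter k f w) = q ^+ k *: iter k f (g w).
  elim: k => [|k IH]; first by rewrite scale1r.
  by rewrite iterS fg IH linearZ /= exprS scalerA.
elim: n => [|n IH]; first by rewrite big_ord1 scale1r.
rewrite iterS IH [RHS]big_ord_recl qbinn0 scale1r /=.
under [in RHS]eq_bigr => k _.
  rewrite /bump leq0n add1n subSS qbinSS scalerDl mulrC -scalerA; over.
rewrite big_split /= addrCA; congr (_ + _).
  by rewrite linear_sum; apply: eq_bigr => k _; rewrite linearZ.
(* The Pascal rule leaves one surplus top term, with coefficient [qbin q n n.+1 = 0]. *)
rewrite [in RHS]big_ord_recr /= (@qbin_small _ _ n n.+1) // scale0r addr0.
rewrite linear_sum big_ord_recl subn0 linearZ /= qbinn0 scale1r; congr (_ + _).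
apply: eq_bigr => k _; rewrite /bump leq0n add1n linearZ /= -iterS gf -iterS.
by rewrite subnSK.
Qed.

Lemma iter_qcommD_prim_root (V : lmodType F) (f g : {linear V -> V}) n v :
  n.-primitive_root q -> (forall w, g (f w) = q *: f (g w)) ->
  iter n (fun w => f w + g w) v = iter n f v + iter n g v.
Proof.
move=> qn fg; rewrite (iter_qcommD _ _ fg).
case: n qn => [/prim_order_gt0//|n qn].
rewrite big_ord_recl big_ord_recr /= big1 => [|k _].
  by rewrite /= /bump leq0n add1n subnn qbinn0 qbinnn !scale1r add0r addrC.
have := qbin_prim_root qn (k := k.+1).
by rewrite /= /bump leq0n add1n ltnS ltn_ord => /(_ isT) ->; rewrite scale0r.
Qed.

Lemma exprD_qcomm_prim_root (A : algType F) (x y : A) n :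
  n.-primitive_root q -> y * x = q *: (x * y) ->
  (x + y) ^+ n = x ^+ n + y ^+ n.
Proof.
(* Powers are iterates of left multiplication applied to [1]. *)
move=> qn yx; have iterM z k : iter k (z \*o idfun) 1 = z ^+ k :> A.
  by elim: k => //= k ->; rewrite exprS.
rewrite -[in RHS](iterM x) -[in RHS](iterM y).
rewrite -iter_qcommD_prim_root => // [|w] /=.
  by elim: n {qn} => //= k <-; rewrite exprS mulrDl.
by rewrite !mulrA yx -scalerAl.
Qed.

End QBinomialTheorem.

(** Evaluate at 0 the factorization of [X^n - 1] over the powers of [q]. *)
Lemma prim_root_prodN (F : fieldType) (q : F) n :
  n.-primitive_root q -> \prod_(i < n) - q ^+ i = -1.
Proof.
move=> qn; have := congr1 (horner^~ 0) (factor_Xn_sub_1 qn).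
rewrite horner_prod big_mkord !hornerE expr0n eqn0Ngt (prim_order_gt0 qn) sub0r.
by move=> <-; apply: eq_bigr => i _; rewrite !hornerE.
Qed.

(** * Central matrices and intertwiners of conjugations *)

Lemma mx_center_scalar (F : fieldType) m (C : 'M[F]_m.+1) :
  (forall B, C * B = B * C) -> C = (C 0 0)%:A.
Proof.
move=> CB; apply/matrixP => i j.
(* In column 0, [delta_mx j 0] isolates [C i j] on the left, and [C 0 0] or zero on the right. *)
have /matrixP/(_ i 0) := CB (delta_mx j 0).
rewrite !mxE (bigD1 j) //= mxE !eqxx mulr1 big1 ?addr0 => [->|k /negPf nkj].
  rewrite (bigD1 0) //= big1 ?addr0 => [|k /negPf nk0].
    by rewrite !mxE eqxx andbT mulr_natl mulr_natr.
  by rewrite mxE nk0 andbF mul0r.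
by rewrite mxE nkj mulr0.
Qed.

(** The hypothesis makes [S * Z] commute with every matrix. *)
Lemma mx_conj_intertwiner (F : fieldType) m (T S Z : 'M[F]_m.+1) :
  S * T = 1 -> T * S = 1 -> (forall B, Z * B = T * B * S * Z) ->
  exists c : F, Z = c *: T.
Proof.
move=> ST TS ZB; have [c Sc] : exists c : F, S * Z = c%:A.
  exists ((S * Z) 0 0); apply: mx_center_scalar => B.
  by rewrite -mulrA ZB !mulrA ST mul1r.
by exists c; rewrite -[Z]mul1r -TS -mulrA Sc -scalerAr mulr1.
Qed.

(** * Twisted inner derivations and their iterates *)

Section TwistedDerivation.
Variables (F : fieldType) (m : nat) (T S : 'M[F]_m.+1).
Hypotheses (ST : S * T = 1) (TS : T * S = 1).

Definition twisted_der (X B : 'M[F]_m.+1) := X * B - T * B * S * X.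

Lemma twisted_derD X c B : twisted_der (X + c *: T) B = twisted_der X B.
Proof.
rewrite /twisted_der mulrDl mulrDr -scalerAl -scalerAr -(mulrA _ S T) ST mulr1.
by rewrite opprD addrACA subrr addr0.
Qed.

Let SK Z : S * (T * Z) = Z. Proof. by rewrite mulrA ST mul1r. Qed.
Let TK Z : T * (S * Z) = Z. Proof. by rewrite mulrA TS mul1r. Qed.

Lemma iter_twisted_der (q : F) n X B :
  n.-primitive_root q -> T * X = q *: (X * T) ->
  iter n (twisted_der X) B = X ^+ n * B - T ^+ n * B * S ^+ n * X ^+ n.
Proof.
move=> qn TX.
have XS : X * S = q *: (S * X).
  by rewrite -[X * S]SK (mulrA T) TX -scalerAl -!mulrA TS mulr1 scalerAr.
have XnS k : X ^+ k * S = q ^+ k *: (S * X ^+ k).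
  elim: k => [|k IH]; first by rewrite scale1r mulr1 mul1r.
  rewrite exprS -mulrA IH -scalerAr (mulrA X) XS -scalerAl scalerA -exprSr.
  by rewrite !mulrA.
pose f := X \*o @idfun 'M[F]_m.+1.
pose g := (S * X) \o* (- T \*o @idfun 'M[F]_m.+1).
have iterf k : iter k f B = X ^+ k * B.
  by elim: k => [|k IH]; rewrite ?mul1r // iterS IH /f /= mulrA exprS.
(* Each application of [g] carries an [S] leftwards past [X ^+ k] and contributes [- q ^+ k]; over
   [n] applications these factors multiply to -1. *)
have iterg k : iter k g B =
    \prod_(i < k) - q ^+ i *: (T ^+ k * B * S ^+ k * X ^+ k).
  elim: k => [|k IH]; first by rewrite big_ord0 scale1r mul1r !mulr1.
  rewrite iterS IH /g big_ord_recr /= -scalerAr -scalerAl -scalerA; congr (_ *: _).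
  rewrite !mulrA -(mulrA _ _ S) XnS -scalerAr -scalerAl scaleNr !mulNr scalerN.
  by rewrite (exprS T) (exprSr S) (exprSr X) !mulrA.
have -> : iter n (twisted_der X) B = iter n (fun w => f w + g w) B.
  by apply: eq_iter => w; rewrite /twisted_der /f /g /= !mulNr !mulrA.
rewrite (iter_qcommD_prim_root _ qn) => [|w].
  by rewrite iterf iterg prim_root_prodN // scaleN1r.
by rewrite /f /g /= !mulrA mulNr TX mulrN !mulNr scalerN -!scalerAl.
Qed.

Lemma qcomm_shift (q : F) X :
  q != 1 -> (forall B, T * twisted_der X B * S = q *: twisted_der X (T * B * S)) ->
  exists c : F, T * (X + c *: T) = q *: ((X + c *: T) * T).
Proof.
move=> q1 dX.
have [B|c Zc] := @mx_conj_intertwiner _ _ T S (T * X * S - q *: X) ST TS.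
  (* Testing at [S * B * T] turns the argument on the right of [dX] into [B]. *)
  have := dX (S * B * T); rewrite /twisted_der.
  rewrite mulrBl !mulrBr mulrBl -!mulrA TS ?mulr1 !SK !TK scalerBr -scalerAl.
  rewrite -!scalerAr => /eqP; rewrite subr_eq => /eqP ->.
  by rewrite addrAC [X in X + _ = _]addrAC subrr add0r addrC.
(* Adding [d *: T] to [X] absorbs the error [c *: (T * T)] once [c + d = q * d], solvable because
   [q != 1]. *)
exists (c / (q - 1)).
have TX : T * X = q *: (X * T) + c *: (T * T).
  by rewrite [c *: _]scalerAl -Zc mulrBl -!mulrA ST mulr1 -scalerAl addrC subrK.
rewrite mulrDr mulrDl TX -scalerAr -scalerAl scalerDr -addrA scalerA -scalerDl.
congr (_ + _ *: _); rewrite -[X in X + _](@divfK _ (q - 1)) ?subr_eq0 //.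
by rewrite mulrBr mulr1 subrK mulrC.
Qed.

Lemma exprn_twisted_der (q a : F) n X :
  q != 1 -> n.-primitive_root q ->
  (forall B, T * twisted_der X B * S = q *: twisted_der X (T * B * S)) ->
  (forall B, iter n (twisted_der X) B = a *: (B - T ^+ n * B * S ^+ n)) ->
  exists c, X ^+ n = a%:A + c *: T ^+ n.
Proof.
move=> q1 qn dX dXn; have [c TY] := qcomm_shift q1 dX.
pose Y := X + c *: T; rewrite -/Y in TY.
have STn : S ^+ n * T ^+ n = 1.
  by rewrite -exprMn_comm ?ST ?expr1n // /GRing.comm ST TS.
have TSn : T ^+ n * S ^+ n = 1.
  by rewrite -exprMn_comm ?TS ?expr1n // /GRing.comm ST TS.
have [B|b Yb] := @mx_conj_intertwiner _ _ (T ^+ n) (S ^+ n) (Y ^+ n - a%:A) STn TSn.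
  have := dXn B; rewrite -(eq_iter (fun C => twisted_derD X c C)).
  rewrite (iter_twisted_der _ qn TY) scalerBr => /eqP.
  rewrite mulrBl mulrBr mulr_algl mulr_algr subr_eq => /eqP ->.
  by rewrite addrAC [X in X + _ = _]addrAC subrr add0r addrC.
exists (b + (- c) ^+ n).
have -> : X = Y + (- c) *: T by rewrite scaleNr addrK.
rewrite (exprD_qcomm_prim_root qn) ?exprZn; last first.
  by rewrite -scalerAl TY -scalerAr scalerA scalerA mulrC.
by rewrite scalerDl -Yb addrA [a%:A + _]addrC subrK.
Qed.

End TwistedDerivation.

(** * Group-like and skew-primitive elements *)

Section HopfElements.
Variables (F : fieldType) (H : algType F) (S : hopf_structure H).

Lemma sweedler_grp (W : lmodType F) (f : H -> H -> W) g :
  is_bilinear f -> comul S g = g ⊗ g -> sweedler S g f = f g g.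
Proof. by move=> fP gE; rewrite /sweedler gE tlift_tens. Qed.

Lemma sweedler_skew (W : lmodType F) (f : H -> H -> W) g x :
  is_bilinear f -> comul S x = x ⊗ 1 + g ⊗ x -> sweedler S x f = f x 1 + f g x.
Proof.
move=> fP xE; rewrite /sweedler xE.
by rewrite -[x ⊗ 1]scale1r tlift_is_linear // scale1r !tlift_tens.
Qed.

Lemma counit_bilinear : is_bilinear (fun h k : H => counit S h *: k).
Proof.
split=> [k c h h'|h c k k']; first by rewrite linearP scalerDl scalerA.
by rewrite scalerDr !scalerA mulrC.
Qed.

(** The counit axiom reads [counit S g *: g = g]. *)
Lemma counit_grp g : g != 0 -> comul S g = g ⊗ g -> counit S g = 1.
Proof.
move=> g0 gE; have := counitl S g.
rewrite -/(sweedler S g _) (sweedler_grp counit_bilinear gE) => /eqP.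
rewrite -subr_eq0 -[X in _ - X]scale1r -scalerBl scaler_eq0 (negPf g0) orbF.
by rewrite subr_eq0 => /eqP.
Qed.

Lemma counit_skew g x : counit S g = 1 -> comul S x = x ⊗ 1 + g ⊗ x ->
  counit S x = 0.
Proof.
move=> g1 xE; have := counitl S x.
rewrite -/(sweedler S x _) (sweedler_skew counit_bilinear xE) g1 scale1r => /eqP.
by rewrite -subr_eq0 addrK scaler_eq0 oner_eq0 orbF => /eqP.
Qed.

Variable A : algType F.

Lemma mul_bilinear (f g : {linear H -> A}) : is_bilinear (fun h k : H => f h * g k).
Proof.
split=> [k c h h'|h c k k']; first by rewrite linearP mulrDl -scalerAl.
by rewrite linearP mulrDr -scalerAr.
Qed.

Lemma inner_bilinear (f g : {linear H -> A}) a :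
  is_bilinear (fun h k : H => f h * a * g k).
Proof. exact: (mul_bilinear (a \o* f) g). Qed.

Variables u v : {linear H -> A}.
Hypotheses (u1 : u 1 = 1) (uv : conv_inverse S u v).

Lemma conv_inverse_grp g : g != 0 -> comul S g = g ⊗ g ->
  u g * v g = 1 /\ v g * u g = 1.
Proof.
move=> g0 gE; have [] := uv g.
rewrite !(sweedler_grp (mul_bilinear _ _) gE) counit_grp //.
by rewrite scale1r.
Qed.

Lemma conv_inverse1 : v 1 = 1.
Proof.
by have [] := conv_inverse_grp (oner_neq0 _) (comul1 S); rewrite u1 mul1r.
Qed.

(** The convolution identity at [x] reads [u x * v 1 + u g * v x = 0]; multiply by [v g]. *)
Lemma conv_inverse_skew g x : g != 0 -> comul S g = g ⊗ g ->
  comul S x = x ⊗ 1 + g ⊗ x -> v x = - (v g * u x).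
Proof.
move=> g0 gE xE; have [+ _] := uv x.
rewrite (sweedler_skew (mul_bilinear _ _) xE) (counit_skew (counit_grp g0 gE) xE).
rewrite conv_inverse1 mulr1 scale0r addrC => /eqP; rewrite addr_eq0 => /eqP uvx.
have [_ vug] := conv_inverse_grp g0 gE.
by rewrite -[LHS]mul1r -vug -mulrA uvx mulrN.
Qed.

End HopfElements.

(** * The generators and their action *)

Section PointedGenerators.
Variables (F : fieldType) (gT : finGroupType) (n : nat) (R : qls F gT n).
Variable D : datum R.

Lemma Pgrp1 : Pgrp D 1%g = 1.
Proof. exact: P_relation (P_one _ _ _). Qed.

Lemma PgrpM g h : Pgrp D (g * h)%g = Pgrp D g * Pgrp D h.
Proof. exact: P_relation (P_mul _ _ _ _ _). Qed.

Lemma PgrpX g k : Pgrp D (g ^+ k)%g = Pgrp D g ^+ k.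
Proof.
by elim: k => [|k IH]; rewrite ?Pgrp1 // expgS PgrpM IH exprS.
Qed.

Lemma Pgrp_neq0 g : Pgrp D g != 0.
Proof.
apply/eqP => g0; have := oner_neq0 (P D).
by rewrite -Pgrp1 -(mulgV g) PgrpM g0 mul0r eqxx.
Qed.

End PointedGenerators.

Lemma module_algebra_exp (F : fieldType) (H A : algType F) (S : hopf_structure H)
    (act : H -> A -> A) k h a :
  module_algebra S act -> act (h ^+ k) a = iter k (act h) a.
Proof.
move=> actP; elim: k => [|k IH]; first by rewrite expr0 (act1h actP).
by rewrite exprS (actMh actP) IH.
Qed.

Unset Implicit Arguments.
Set Strict Implicit.

Theorem theorem5p5 (F : fieldType) (gT : finGroupType)
  (abG : abelian [set: gT]) (ntG : [set: gT] != 1%g)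
  (dualG : exists f : gT -> character F gT, bijective f)
  (n : nat) (R : qls F gT n) (D : datum R)
  (Hf : hopf_structure (P D))
  (comul_grp : forall g, comul Hf (Pgrp D g) = Pgrp D g ⊗ Pgrp D g)
  (comul_var : forall i, comul Hf (Pvar D i) =
     Pvar D i ⊗ (1 : P D) + Pgrp D (qa R i) ⊗ Pvar D i)
  (m : nat) (act : P D -> 'M[F]_m.+1 -> 'M[F]_m.+1)
  (u : {linear P D -> 'M[F]_m.+1}) :
  module_algebra Hf act -> inner_via Hf act u ->
  forall i : 'I_n, exists sigma : F,
    u (Pvar D i) ^+ qN R i =
      (mu D i)%:R *: 1 + sigma *: u (Pgrp D (qa R i)) ^+ qN R i.
Proof.
move=> actP [u1 [v uv actE]] i.
set g := Pgrp D (qa R i); set x := Pvar D i; set N := qN R i.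
have gE : comul Hf g = g ⊗ g := comul_grp _.
have xE : comul Hf x = x ⊗ 1 + g ⊗ x := comul_var _.
have g0 : g != 0 := Pgrp_neq0 _ _.
have [TS ST] := conv_inverse_grp uv g0 gE.
have actg B : act g B = u g * B * v g.
  by rewrite actE (sweedler_grp (inner_bilinear _ _ _) gE).
have actx B : act x B = twisted_der (u g) (v g) (u x) B.
  rewrite actE (sweedler_skew (inner_bilinear _ _ _) xE) (conv_inverse1 u1 uv).
  by rewrite (conv_inverse_skew u1 uv g0 gE xE) mulr1 mulrN !mulrA.
(* [u] need not be multiplicative, so [u (g ^+ k)] and [u g ^+ k] may differ; the actions they
   induce agree. *)
have actgX k B : act (g ^+ k) B = u g ^+ k * B * v g ^+ k.
  rewrite (module_algebra_exp _ _ _ actP).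
  elim: k => [|k IH]; first by rewrite mul1r mulr1.
  by rewrite iterS IH actg exprS exprSr !mulrA.
pose actl B : {linear P D -> 'M[F]_m.+1} :=
  HB.pack (act^~ B) (GRing.isLinear.Build _ _ _ _ _ (act_linearl actP B)).
have actlE h B : act h B = actl B h by [].
apply: (exprn_twisted_der ST TS (q := qq R i)) => [||B|B].
- exact: qls_neq1.
- exact: qN_prim.
(* The coefficient in [P_comm] at [qa R i] is [qq R i] by definition. *)
- rewrite -actg -!actx -actg -!(actMh actP) (P_relation (P_comm _ _ _ _ _)).
  by rewrite !actlE linearZ.
(* The iterate is the action of [x ^+ N], which [P_pow] rewrites in group elements. *)
rewrite -(eq_iter actx) -(module_algebra_exp _ _ _ actP).
rewrite (P_relation (P_pow _ _ _ _)) PgrpX !actlE linearZ linearB /= (act1h actP).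
by rewrite actgX.
Qed.
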